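(* Let $\sigma\in\mathbb{R}$ and $\beta\in\mathbb{R}$ with $|\beta|<1$, and for $H\in(0,1)$ let $(X_t^H)_{t\in[0,1]}$ be the real-valued stochastic process defined by $$dX_t^H=\beta X_t^H\,dt+\sigma\,dB_t^H,\qquad X_0^H=0,$$ where $B^H$ is a one-dimensional fractional Brownian motion with Hurst parameter $H$. Then there exists a constant $C>0$, independent of $H$, such that for every $H\in(0,1)$ $$\mathbb{E}\Big[\sup_{t\in[0,1]}X_t^H\Big]\le C\left\{|\sigma|\sqrt{C_\beta}+|\sigma|\sqrt{\frac{C_\beta\,\pi}{H}}\right\},\qquad\text{where } C_\beta=e^{3\beta}.$$
   Context: A (one-dimensional) fractional Brownian motion on $[0,1]$ with Hurst parameter $H\in(0,1)$ is a centered Gaussian process $(B^H_t)_{t\in[0,1]}$ with continuous paths and covariance $\mathbb{E}[B^H_tB^H_s]=\tfrac12\left(|t|^{2H}+|s|^{2H}-|t-s|^{2H}\right)$. The linear stochastic differential equation is understood pathwise in integral form: $X^H_t=X^H_0+\beta\int_0^tX^H_s\,ds+\sigma B^H_t$ for all $t\in[0,1]$ (its unique continuous solution is a fractional Ornstein-Uhlenbeck process). *)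

(* Defs.v *)
From HB Require Import structures.
From mathcomp Require Import all_boot all_order all_algebra.
From mathcomp Require Import all_classical all_reals all_analysis.

Set Implicit Arguments.
Unset Strict Implicit.
Unset Printing Implicit Defensive.

Import Order.TTheory GRing.Theory Num.Theory.
Import numFieldNormedType.Exports.

Local Open Scope classical_set_scope.
Local Open Scope ring_scope.

(* A one-dimensional normal law, possibly degenerate.  The case of zero
   variance is stated separately because [normal_prob m 0] is not the Dirac
   mass at [m] (it is the uniform law on [0, 1]). *)
Definition gaussian d (T : measurableType d) (R : realType)
    (P : probability T R) (Y : {RV P >-> R}) : Prop :=
  exists m s : R, forall A : set R, measurable A ->
    distribution P Y A = if s == 0 then \d_m A else normal_prob m s A.

Arguments gaussian {d T R} P Y.

(* Processes are indexed by the whole real line, but only their values at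
   times in [I] (below: in [0, 1]) are ever constrained or used. *)
Definition gaussian_process d (T : measurableType d) (R : realType)
    (P : probability T R) (I : set R) (B : R -> {RV P >-> R}) : Prop :=
  forall (n : nat) (t c : 'I_n -> R), (forall i, I (t i)) ->
    gaussian P (\sum_(i < n) c i *: (B (t i) : {mfun T >-> R})).

Arguments gaussian_process {d T R} P I B.

Record fractional_brownian_motion d (T : measurableType d) (R : realType)
    (P : probability T R) (H : R) (B : R -> {RV P >-> R}) : Prop := {
  fbm_gaussian : gaussian_process P `[0, 1] B ;
  fbm_centered : forall t : R, t \in `[0, 1] -> ('E_P[B t] = 0)%E ;
  fbm_covariance : forall s t : R, s \in `[0, 1] -> t \in `[0, 1] ->
    ('E_P[(B t \* B s)%R] =
      (2^-1 * (`|t| `^ (2 * H) + `|s| `^ (2 * H) - `|t - s| `^ (2 * H)))%:E)%E ;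
  fbm_continuous : forall w, {within `[0, 1], continuous (fun t : R => B t w)}
}.

Arguments fractional_brownian_motion {d T R} P H B.

(* dX = beta X dt + sigma dB with X_0 = x0, pathwise on [0, 1].  The equation is
   only asked for almost every path since the axioms above give B_0 = 0 almost
   surely, not everywhere. *)
Record linear_sde_solution d (T : measurableType d) (R : realType)
    (P : probability T R) (beta sigma x0 : R)
    (B X : R -> {RV P >-> R}) : Prop := {
  sde_continuous : forall w, {within `[0, 1], continuous (fun t : R => X t w)} ;
  sde_init : {ae P, forall w, X 0 w = x0} ;
  sde_equation : {ae P, forall w, forall t : R, t \in `[0, 1] ->
    X t w = X 0 w
            + beta * (\int[lebesgue_measure]_(s in `[0, t]) X s w)
            + sigma * B t w}
}.

Arguments linear_sde_solution {d T R} P beta sigma x0 B X.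

(* Main.v *)
Require Import Defs.
From HB Require Import structures.
From mathcomp Require Import all_boot all_order all_algebra.
From mathcomp Require Import all_classical all_reals all_analysis.
From mathcomp Require Import measurable_realfun.
From mathcomp Require Import ring lra zify.

Set Implicit Arguments.
Unset Strict Implicit.
Unset Printing Implicit Defensive.

Import Order.TTheory GRing.Theory Num.Theory.
Import numFieldNormedType.Exports.

Local Open Scope classical_set_scope.
Local Open Scope ring_scope.

(** The constant may depend on beta, so the equation only enters through a
    deterministic estimate.  If M is the maximum of |X| on [0, 1], attained at c,
    the equation at time c gives M <= |beta| M + |sigma| sup |B|; since |beta| < 1,
    sup |X| <= |sigma| / (1 - |beta|) * sup |B| ([linear_sde_le]).  It remains to
    prove that E sup |B| <= K (1 + sqrt (1 / H)) for a universal constant K.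

    This is Dudley's entropy bound for the metric |t - s|^H, proved by chaining.
    The rate in H depends on the choice of the nets.  Chaining along all dyadic
    grids has links of standard deviation 2^(-kH) with 2^k points at level k, and
    sum_k 2^(-kH) sqrt k is of order H^(-3/2): too large.  One must use nets whose
    radius halves at each level for the metric |t - s|^H, that is only every m-th
    dyadic grid, with m about 1 / H.  The links of level k then have standard
    deviation at most 2^-k, there are about 2^(m (k + 1)) of them, and the maximal
    inequality bounds the mean of their maximum by a constant times
    2^-k sqrt (m (k + 1)) ([expectation_chain_level]).  The sum over k is
    O(sqrt m) = O(H^(-1/2)) ([expectation_chain_bound]).

    The maximal inequality ([expectation_bigmax_norm_le]) needs only the Gaussian
    moment generating function, so all that is used of the law of an increment of
    B is E exp (l Y) <= exp (3/2 l^2 E Y^2) ([centered_gaussian_mgf]).  The constant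
    3 is not optimal, but it lets the variance parameter of the law be compared
    with E Y^2 without computing the second moment of the normal law.

    The chaining bound is a measurable function that dominates |B| at every time and
    for every outcome; the expectation of the supremum of X, a supremum over
    uncountably many times, is compared with it through [integral_le_of_ae_le]. *)

(** * Exponential moments of Gaussian variables *)

(** The normal density is almost everywhere equal to the Radon-Nikodym derivative of
    the normal law, for which the change of variables is known. *)
Lemma ge0_integral_normal_prob (R : realType) (m s : R) (f : R -> \bar R) :
  measurable_fun setT f -> (forall y, 0 <= f y)%E ->
  (\int[normal_prob m s]_y f y =
   \int[lebesgue_measure]_y (f y * (normal_pdf m s y)%:E))%E.
Proof.
move=> mf f0.
have dom := normal_prob_dominates m s.
rewrite -(Radon_Nikodym_SigmaFinite.change_of_variables dom)//.
have iRN := Radon_Nikodym_SigmaFinite.f_integrable dom.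
have mpdf : measurable_fun setT (EFin \o normal_pdf m s).
  by apply/measurable_EFinP; exact: measurable_normal_pdf.
apply: ae_eq_integral => //.
- by apply: emeasurable_funM => //; exact: measurable_int iRN.
- exact: emeasurable_funM.
- apply: ae_eqe_mul2l; apply: integral_ae_eq => // E _ mE.
  by rewrite -Radon_Nikodym_SigmaFinite.f_integral.
Qed.

(** Multiplying the density by exp (l y) shifts the mean by l s^2, up to a
    constant factor, which is therefore the integral. *)
Lemma normal_mgf (R : realType) (m s l : R) : s != 0 ->
  (\int[normal_prob m s]_y (expR (l * y))%:E =
   (expR (l * m + l ^+ 2 * s ^+ 2 / 2))%:E)%E.
Proof.
move=> s0; have s20 : s ^+ 2 != 0 by rewrite sqrf_eq0.
rewrite ge0_integral_normal_prob; last 2 first.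
- by apply/measurable_EFinP; apply: measurableT_comp => //; exact: mulrl_measurable.
- by move=> y; rewrite lee_fin expR_ge0.
transitivity (\int[lebesgue_measure]_y
    ((expR (l * m + l ^+ 2 * s ^+ 2 / 2))%:E *
     (normal_pdf (m + l * s ^+ 2) s y)%:E))%E; last first.
  rewrite ge0_integralZl//=.
  - by rewrite integral_normal_pdf mule1.
  - by apply/measurable_EFinP; exact: measurable_normal_pdf.
  - by move=> y _; rewrite lee_fin normal_pdf_ge0.
apply: eq_integral => y _; rewrite -!EFinM !normal_pdfE//; congr EFin.
rewrite mulrCA [RHS]mulrCA; congr (_ * _).
rewrite /normal_fun -!expRD; congr expR.
by field.
Qed.

(** The weight is chosen so that its product with the density of N(0, s^2) has the
    shape of the density of N(0, s^2 / 4): the integral is the ratio of the two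
    standard deviations. *)
Lemma integral_normal_prob_expsqr (R : realType) (s : R) : s != 0 ->
  (\int[normal_prob 0 s]_y (expR (- (3 / 2 * (y / s) ^+ 2)))%:E = 2^-1%:E)%E.
Proof.
move=> s0; have s20 : s / 2 != 0 by rewrite mulf_neq0.
rewrite ge0_integral_normal_prob; last 2 first.
- apply/measurable_EFinP; apply: measurableT_comp => //.
  apply: measurableT_comp => //; apply: measurable_funM => //.
  by apply: measurable_funX; apply: measurable_funM.
- by move=> y; rewrite lee_fin expR_ge0.
transitivity (\int[lebesgue_measure]_y
    (2^-1%:E * (normal_pdf 0 (s / 2) y)%:E))%E; last first.
  rewrite ge0_integralZl//=.
  - by rewrite integral_normal_pdf mule1.
  - by apply/measurable_EFinP; exact: measurable_normal_pdf.
  - by move=> y _; rewrite lee_fin normal_pdf_ge0.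
apply: eq_integral => y _; rewrite -!EFinM !normal_pdfE//; congr EFin.
have -> : normal_peak (s / 2) = 2 * normal_peak s.
  rewrite /normal_peak [X in Num.sqrt X](_ : _ = (2^-1) ^+ 2 * (s ^+ 2 * pi *+ 2)).
    by rewrite sqrtrM ?sqr_ge0// sqrtr_sqr ger0_norm ?invr_ge0// invfM invrK.
  by rewrite -mulr_natl; field.
rewrite mulrCA [RHS]mulrA [in RHS](mulrA 2^-1) mulVf// mul1r; congr (_ * _).
rewrite /normal_fun -!expRD; congr expR.
by field; rewrite s0.
Qed.

(** The two cases in the definition of a Gaussian law are merged here into a
    formula for the integral of a nonnegative function of the variable. *)
Lemma gaussian_law d (T : measurableType d) (R : realType)
    (P : probability T R) (Y : {RV P >-> R}) :
  gaussian P Y -> exists m s : R, forall f : R -> \bar R,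
    measurable_fun setT f -> (forall y, 0 <= f y)%E ->
    (\int[P]_w f (Y w) =
     if s == 0%R then f m else \int[normal_prob m s]_y f y)%E.
Proof.
move=> [m [s Yms]]; exists m, s => f mf f0.
case: ifPn => [s0|/negPf s0].
  rewrite -[LHS](ge0_integral_distribution _ mf f0).
  rewrite (@eq_measure_integral _ _ _ _ \d_m).
    by rewrite integral_dirac//= diracT mul1e.
  by move=> A mA _; rewrite [LHS]Yms// s0.
(* [normal_prob] lives on the copy [measurableTypeR R] of the measurable space R *)
have mY : measurable_fun setT (Y : T -> measurableTypeR R) by exact: (measurable_funPT Y).
have mf' : measurable_fun setT (f : measurableTypeR R -> \bar R) by exact: mf.
rewrite -[LHS](ge0_integral_pushforward mY P measurableT mf')//.
rewrite (@eq_measure_integral _ _ _ _ (normal_prob m s))// => A mA _.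
by have := Yms A mA; rewrite s0.
Qed.

(** The law of Y has parameters m and s which have to be related to the moments
    of Y.  First, exp x >= 1 + x gives E exp (k Y) >= 1 for all k, hence
    k m + k^2 s^2 / 2 >= 0 for all k, which forces m = 0.  Second, the inequality
    y^2 >= 2/3 s^2 (1 - exp (- 3/2 (y / s)^2)) has a right-hand side of mean s^2 / 3,
    hence s^2 <= 3 E Y^2. *)
Lemma centered_gaussian_mgf d (T : measurableType d) (R : realType)
    (P : probability T R) (Y : {RV P >-> R}) (v : R) :
  gaussian P Y -> P.-integrable setT (EFin \o Y) -> ('E_P[Y] = 0)%E ->
  (\int[P]_w (Y w ^+ 2)%:E <= v%:E)%E ->
  forall l : R, (\int[P]_w (expR (l * Y w))%:E <= (expR (3 / 2 * l ^+ 2 * v))%:E)%E.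
Proof.
move=> /gaussian_law[m [s law]] intY EY Y2 l.
have mexp k : measurable_fun setT (fun y : R => (expR (k * y))%:E).
  by apply/measurable_EFinP; apply: measurableT_comp => //; exact: mulrl_measurable.
have mgf k : (\int[P]_w (expR (k * Y w))%:E =
    (expR (k * m + k ^+ 2 * s ^+ 2 / 2))%:E)%E.
  rewrite (law (fun y => (expR (k * y))%:E))//.
  case: eqVneq => [->|s0]; last exact: normal_mgf.
  by rewrite expr0n/= mulr0 mul0r addr0.
have m0 : m = 0.
  have mge0 k : 0 <= k * m + k ^+ 2 * s ^+ 2 / 2.
    rewrite -(ler_expR 0) expR0 -lee_fin -mgf.
    have -> : 1%:E = (\int[P]_w (1 + k * Y w)%:E)%E.
      rewrite (_ : (fun _ => _) = (fun w => cst 1 w + k%:E * (Y w)%:E)%E) //.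
      rewrite integralD//=; last 2 first.
      - exact: finite_measure_integrable_cst.
      - exact: integrableZl.
      rewrite integralZl//= -expectation_def EY mule0 adde0.
      by rewrite integral_cst//= probability_setT mule1.
    apply: le_integral => //.
    - rewrite (_ : (fun _ => _) = (cst 1%:E \+ (fun w => k%:E * (Y w)%:E))%E) //.
      apply: integrableD => //; first exact: finite_measure_integrable_cst.
      exact: integrableZl.
    - apply/integrableP; split; first exact: measurableT_comp (mexp k) _.
      under eq_integral do rewrite gee0_abs ?lee_fin ?expR_ge0//.
      by rewrite mgf ltry.
    - by move=> w _; rewrite lee_fin expR_ge1Dx.
  have [s0|s0] := eqVneq s 0.
    have := mge0 (- m); rewrite s0 expr0n/= mulr0 mul0r addr0 mulNr -expr2.
    by rewrite oppr_ge0 => mle; apply/eqP; rewrite -sqrf_eq0 eq_le mle sqr_ge0.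
  (* the minimum over k of the quadratic polynomial in [mge0] *)
  have := mge0 (- m / s ^+ 2).
  rewrite (_ : _ + _ = - (m ^+ 2 / s ^+ 2 / 2)); last by field.
  rewrite oppr_ge0 pmulr_lle0 ?invr_gt0// pmulr_lle0 ?invr_gt0 ?exprn_even_gt0//.
  by move=> mle; apply/eqP; rewrite -sqrf_eq0 eq_le mle sqr_ge0.
have s2v : s ^+ 2 <= 3 * v.
  have v0 : 0 <= v.
    by rewrite -lee_fin (le_trans _ Y2)// integral_ge0// => w _; rewrite lee_fin sqr_ge0.
  have [->|s0] := eqVneq s 0; first by rewrite expr0n/= mulr_ge0.
  have c0 : 0 <= 2 / 3 * s ^+ 2 by rewrite mulr_ge0 ?sqr_ge0.
  pose e (y : R) := expR (- (3 / 2 * (y / s) ^+ 2)).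
  have me : measurable_fun setT (EFin \o e).
    apply/measurable_EFinP; apply: measurableT_comp => //.
    apply: measurableT_comp => //; apply: measurable_funM => //.
    by apply: measurable_funX; apply: measurable_funM.
  have Ee : (\int[P]_w (e (Y w))%:E = 2^-1%:E)%E.
    rewrite (law (EFin \o e))//; last by move=> y; rewrite /= lee_fin expR_ge0.
    by rewrite (negPf s0) m0 integral_normal_prob_expsqr.
  have mY2 : measurable_fun setT (fun w => (Y w ^+ 2)%:E).
    by apply/measurable_EFinP; exact: measurable_funX.
  have meY : measurable_fun setT (fun w => (e (Y w))%:E).
    exact: measurableT_comp me _.
  have : ((2 / 3 * s ^+ 2)%:E <=
      \int[P]_w ((Y w ^+ 2)%:E + (2 / 3 * s ^+ 2)%:E * (e (Y w))%:E))%E.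
    rewrite -[leLHS]mule1 -(probability_setT P) -integral_cst//.
    apply: ge0_le_integral => //.
    - by apply: emeasurable_funD => //; exact: measurable_funeM.
    - move=> w _; rewrite -EFinM -EFinD lee_fin.
      have : 1 - (3 / 2 * (Y w / s) ^+ 2) <= e (Y w) by exact: expR_ge1Dx.
      move/(ler_wpM2l c0).
      rewrite mulrBr mulr1 (_ : _ * (3 / 2 * _) = Y w ^+ 2); last by field.
      by lra.
  rewrite ge0_integralD//; last 3 first.
  - by move=> w _; rewrite lee_fin sqr_ge0.
  - by move=> w _; rewrite -EFinM lee_fin mulr_ge0// expR_ge0.
  - exact: measurable_funeM.
  rewrite ge0_integralZl//; last by move=> w _; rewrite lee_fin expR_ge0.
  rewrite Ee => /le_trans /(_ (leeD2r _ Y2)); rewrite -EFinM -EFinD lee_fin.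
  by lra.
rewrite mgf m0 mulr0 add0r lee_fin ler_expR.
have := ler_wpM2l (sqr_ge0 l) s2v; lra.
Qed.

(** * A maximal inequality *)

Lemma bigmax_norm_ge0 (R : realType) n (F : 'I_n -> R) :
  0 <= \big[Num.max/0]_i `|F i|.
Proof. by rewrite bigmax_idl le_max lexx. Qed.

Lemma measurable_bigmax_norm d (T : measurableType d) (R : realType) (n : nat)
    (Y : 'I_n -> T -> R) : (forall i, measurable_fun setT (Y i)) ->
  measurable_fun setT (fun w => \big[Num.max/0]_(i < n) `|Y i w|).
Proof.
move=> mY.
have -> : (fun w => \big[Num.max/0]_(i < n) `|Y i w|) =
    \big[(fun f g : T -> R => f \max g)/cst 0]_(i < n) (fun w => `|Y i w|).
  by apply/funext => w; elim/big_ind2: _ => // f1 x1 f2 x2 -> ->.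
elim/big_ind: _ => //.
- by move=> f g mf mg; exact: measurable_maxr.
- by move=> i _; exact: measurableT_comp.
Qed.

(** The exponential moment method: since x <= exp (l x) / l, every |Y i| is at most
    a + (exp (l (Y i - a)) + exp (l (- Y i - a))) / l, and adding up the exponential
    terms bounds the maximum.  The mean of the bound is at most
    a + 2 n / l * exp (3/2 l^2 delta^2 - l a).  The parameters are such that the
    exponential equals exp (- q^2), which compensates the factor 2 n. *)
Lemma expectation_bigmax_norm_le d (T : measurableType d) (R : realType)
    (P : probability T R) (n : nat) (Y : 'I_n -> {RV P >-> R}) (delta q : R) :
  0 < delta -> 1 <= q -> (2 * n)%:R <= expR (q ^+ 2) ->
  (forall i l, (\int[P]_w (expR (l * Y i w))%:E <=
    (expR (3 / 2 * l ^+ 2 * delta ^+ 2))%:E)%E) ->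
  (\int[P]_w (\big[Num.max/0%R]_(i < n) `|Y i w|)%:E <=
    (7 / 2 * delta * q)%:E)%E.
Proof.
move=> d0 q1 nq mgf; have q0 : 0 < q by rewrite (lt_le_trans _ q1).
pose l := q / delta; pose a := 5 / 2 * delta * q.
have l0 : 0 < l by rewrite divr_gt0.
pose e i w := expR (l * (Y i w - a)) + expR (l * (- Y i w - a)).
pose c := l^-1 * expR (- (l * a)).
have c0 : 0 <= c by rewrite mulr_ge0 ?invr_ge0 ?expR_ge0 ?ltW.
have mexp k i : measurable_fun setT (fun w => (expR (k * Y i w))%:E).
  apply/measurable_EFinP; apply: measurableT_comp => //.
  by apply: measurable_funM.
pose g i w : \bar R := ((expR (l * Y i w))%:E + (expR (- l * Y i w))%:E)%E.
have g0 i w : (0 <= g i w)%E by rewrite adde_ge0 ?lee_fin ?expR_ge0.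
have mg i : measurable_fun setT (g i) by apply: emeasurable_funD.
have le_e i w : `|Y i w| <= a + l^-1 * e i w.
  have expx x : x <= l^-1 * expR (l * x).
    rewrite ler_pdivlMl// (le_trans _ (expR_ge1Dx _))//.
    by rewrite lerDr.
  rewrite ler_norml; apply/andP; split; rewrite /e mulrDr.
    have := expx (- Y i w - a).
    have : 0 <= l^-1 * expR (l * (Y i w - a)).
      by rewrite mulr_ge0 ?expR_ge0 ?invr_ge0 ?ltW.
    by lra.
  have := expx (Y i w - a).
  have : 0 <= l^-1 * expR (l * (- Y i w - a)).
    by rewrite mulr_ge0 ?expR_ge0 ?invr_ge0 ?ltW.
  by lra.
have eg i w : ((l^-1 * e i w)%:E = c%:E * g i w)%E.
  rewrite /g -EFinD -EFinM; congr EFin; rewrite /e /c -[RHS]mulrA.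
  by congr (_ * _); rewrite [RHS]mulrDr -!expRD; congr (expR _ + expR _); ring.
have a0 : 0 <= a by rewrite !mulr_ge0// ltW.
apply: (@le_trans _ _ (\int[P]_w (a%:E + c%:E * \sum_(i < n) g i w))%E).
  apply: ge0_le_integral => //.
  - by move=> w _; rewrite lee_fin bigmax_norm_ge0.
  - apply/measurable_EFinP; apply: measurable_bigmax_norm => i.
    exact: measurable_funPT.
  - apply: emeasurable_funD => //; apply: measurable_funeM.
    exact: emeasurable_sum.
  - move=> w _; rewrite ge0_sume_distrr//.
    under [X in (_ + X)%E]eq_bigr do rewrite -eg.
    rewrite sumEFin -EFinD lee_fin.
    have e0 i : 0 <= l^-1 * e i w.
      by rewrite mulr_ge0 ?invr_ge0 ?addr_ge0 ?expR_ge0 ?ltW.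
    apply: bigmax_le; first by rewrite addr_ge0// sumr_ge0.
    move=> i _; rewrite (le_trans (le_e i w))// lerD2l (bigD1 i)//= lerDl.
    by rewrite sumr_ge0.
have mS : measurable_fun setT (fun w => \sum_(i < n) g i w)%E.
  exact: emeasurable_sum.
rewrite ge0_integralD//; last 2 first.
- by move=> w _; rewrite mule_ge0 ?sume_ge0.
- exact: measurable_funeM.
rewrite ge0_integralZl//; last by move=> w _; exact: sume_ge0.
rewrite integral_cst//= probability_setT mule1 ge0_integral_sum//.
have Eg i : (\int[P]_w g i w <= (2 * expR (3 / 2 * q ^+ 2))%:E)%E.
  have lq : q ^+ 2 = l ^+ 2 * delta ^+ 2 by rewrite /l; field; rewrite gt_eqF.
  rewrite /g ge0_integralD//.
  rewrite mulr_natl mulr2n EFinD lq mulrA leeD// (le_trans (mgf _ _))//.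
  by rewrite sqrrN.
apply: (@le_trans _ _ (a%:E + c%:E * \sum_(i < n) (2 * expR (3 / 2 * q ^+ 2))%:E)%E).
  by rewrite leeD2l// lee_wpmul2l// lee_sum.
rewrite sumEFin -EFinM -EFinD lee_fin sumr_const card_ord -(mulr_natl _ n).
have -> : c * (n%:R * (2 * expR (3 / 2 * q ^+ 2))) =
    l^-1 * ((2 * n)%:R * expR (- q ^+ 2)).
  rewrite /c natrM.
  have -> : - q ^+ 2 = - (l * a) + 3 / 2 * q ^+ 2.
    by rewrite /l /a; field; rewrite gt_eqF.
  by rewrite expRD; ring.
have : (2 * n)%:R * expR (- q ^+ 2) <= 1.
  by rewrite expRN ler_pdivrMr ?expR_gt0// mul1r.
have l'0 : 0 <= l^-1 by rewrite invr_ge0 ltW.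
move/(ler_wpM2l l'0); rewrite mulr1 => le1.
have le2 : l^-1 <= delta * q.
  by rewrite /l invf_div ler_pdivrMr// -mulrA ler_peMr ?mulr_ege1// ltW.
by rewrite /a; lra.
Qed.

(** * Increments of fractional Brownian motion *)

Lemma gaussian_process_increment d (T : measurableType d) (R : realType)
    (P : probability T R) (I : set R) (B : R -> {RV P >-> R}) (s t : R) :
  gaussian_process P I B -> I s -> I t -> gaussian P (B t - B s : {mfun T >-> R}).
Proof.
move=> gB Is It.
have := gB 2%N (fun i => if i == ord0 then t else s)
               (fun i => if i == ord0 then 1 else -1).
rewrite !big_ord_recl big_ord0 /= scale1r scaleN1r addr0; apply.
by move=> i; case: ifP.
Qed.

(** The covariance formula at s = t says that the second moments are finite, and
    |x y| <= x^2 + y^2. *)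
Lemma fbm_prod_integrable d (T : measurableType d) (R : realType)
    (P : probability T R) (H : R) (B : R -> {RV P >-> R}) (s t : R) :
  fractional_brownian_motion P H B -> s \in `[0, 1] -> t \in `[0, 1] ->
  P.-integrable setT (fun w => (B s w * B t w)%:E).
Proof.
move=> fB s01 t01.
have sq u : u \in `[0, 1] -> P.-integrable setT (fun w => (B u w * B u w)%:E).
  move=> u01; apply/integrableP; split.
    by apply/measurable_EFinP; exact: measurable_funM.
  under eq_integral do rewrite gee0_abs ?lee_fin -?expr2 ?sqr_ge0//.
  have := fbm_covariance fB u01 u01; rewrite unlock => Euu.
  by rewrite [X in (X < _)%E]Euu ltry.
apply: (le_integrable _ _ _ (integrableD _ (sq s s01) (sq t t01))) => //.
  by apply/measurable_EFinP; exact: measurable_funM.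
move=> w _; rewrite -EFinD lee_fin normrM.
rewrite [leRHS]ger0_norm -?expr2 ?addr_ge0 ?sqr_ge0//.
rewrite -(real_normK (num_real (B s w))) -(real_normK (num_real (B t w))).
have := sqr_ge0 (`|B s w| - `|B t w|); rewrite sqrrB => h.
have : 0 <= `|B s w| * `|B t w| by rewrite mulr_ge0.
lra.
Qed.

Lemma fbm_integrable d (T : measurableType d) (R : realType)
    (P : probability T R) (H : R) (B : R -> {RV P >-> R}) (t : R) :
  fractional_brownian_motion P H B -> t \in `[0, 1] ->
  P.-integrable setT (EFin \o B t).
Proof.
move=> fB t01.
have i1 : P.-integrable setT (cst 1%:E) by exact: finite_measure_integrable_cst.
have i2 := fbm_prod_integrable fB t01 t01.
apply: (le_integrable _ _ _ (integrableD _ i1 i2)) => //.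
  by apply/measurable_EFinP; exact: measurable_funPT.
move=> w _; rewrite -EFinD lee_fin [leRHS]ger0_norm -?expr2 ?addr_ge0 ?sqr_ge0//.
rewrite -(real_normK (num_real (B t w))).
have := sqr_ge0 (`|B t w| - 1); rewrite sqrrB mulr1 expr1n => h.
have := normr_ge0 (B t w).
lra.
Qed.

(** The increment is centered Gaussian and, by the covariance formula, its second
    moment is |t - s|^(2 H). *)
Lemma fbm_increment_mgf d (T : measurableType d) (R : realType)
    (P : probability T R) (H : R) (B : R -> {RV P >-> R}) (s t l : R) :
  0 < H -> fractional_brownian_motion P H B -> s \in `[0, 1] -> t \in `[0, 1] ->
  (\int[P]_w (expR (l * (B t - B s : {mfun T >-> R}) w))%:E <=
   (expR (3 / 2 * l ^+ 2 * `|t - s| `^ (2 * H)))%:E)%E.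
Proof.
move=> H0 fB s01 t01; have H2 : 2 * H != 0 by rewrite mulf_neq0// gt_eqF.
have is_ := fbm_integrable fB s01; have it := fbm_integrable fB t01.
have Bsub w : (B t - B s : {mfun T >-> R}) w = B t w - B s w by [].
have is2 := fbm_prod_integrable fB s01 s01.
have it2 := fbm_prod_integrable fB t01 t01.
have ist := fbm_prod_integrable fB s01 t01.
have EE u v : u \in `[0, 1] -> v \in `[0, 1] -> (\int[P]_w (B u w * B v w)%:E =
    (2^-1 * (`|v| `^ (2 * H) + `|u| `^ (2 * H) - `|v - u| `^ (2 * H)))%:E)%E.
  move=> u01 v01; have := fbm_covariance fB u01 v01; rewrite unlock => <-. 
  by apply: eq_integral => w _; rewrite /= mulrC.
have gB : gaussian P (B t - B s : {mfun T >-> R}).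
  by apply: (gaussian_process_increment (I := `[0, 1])) => //=; exact: fbm_gaussian fB.
have iB : P.-integrable setT (EFin \o (B t - B s : {mfun T >-> R})).
  exact: (integrableB _ it is_).
have EB : ('E_P[(B t - B s : {mfun T >-> R})] = 0)%E.
  rewrite unlock; under eq_integral do rewrite Bsub EFinB.
  rewrite integralB//=.
  have := fbm_centered fB s01; have := fbm_centered fB t01.
  by rewrite unlock => -> ->; rewrite sube0.
apply: (centered_gaussian_mgf gB iB EB); rewrite le_eqVlt; apply/orP; left; apply/eqP.
transitivity (\int[P]_w ((B t w * B t w)%:E + (B s w * B s w)%:E
                        - 2%:E * (B s w * B t w)%:E))%E.
  apply: eq_integral => w _; rewrite Bsub; apply: (congr1 EFin) => /=; ring.
rewrite integralB//=; last 2 first.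
- exact: integrableD.
- exact: integrableZl.
rewrite integralD//= integralZl//= !EE//; apply: (congr1 EFin) => /=.
rewrite !subrr normr0 powR0//.
by field.
Qed.

(** * Chaining along grids *)

Definition grid_floor (R : realType) (D k : nat) (t : R) : R :=
  (Num.truncn (t * (D ^ k)%:R))%:R / (D ^ k)%:R.

(** Telescoping along the successive grids of mesh D^-k: the index of the point of
    level k below t is the quotient by D of the index of the point of level k + 1,
    so that one passes from a level to the next by one of the links over which the
    maximum is taken.  The level 0 has only the points 0 and 1. *)
Lemma le_norm_chain (R : realType) (b : R -> R) (D n : nat) (t : R) :
  (0 < D)%N -> 0 <= t <= 1 ->
  `|b (grid_floor D n t)| <= `|b 0| + `|b 1| + \sum_(0 <= k < n)
    \big[Num.max/0]_(i < (D ^ k.+1).+1)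
      `|b (i%:R / (D ^ k.+1)%:R) - b ((i %/ D)%:R / (D ^ k)%:R)|.
Proof.
move=> D0 /andP[t0 t1].
have tD0 k : 0 <= t * (D ^ k)%:R by rewrite mulr_ge0.
elim: n => [|n IH].
  rewrite big_geq// addr0 /grid_floor expn0 mulr1 divr1.
  have : (Num.truncn t <= 1)%N.
    by rewrite -ltnS truncn_lt_nat// (le_lt_trans t1)// ltr1n.
  by case: (Num.truncn t) => [|[|//]] _; rewrite ?lerDl ?lerDr.
rewrite big_nat_recr//=.
rewrite addrA (le_trans _ (lerD IH (lexx _)))//.
rewrite addrC -lerBlDr (le_trans (lerB_dist _ _))//.
have iN : (Num.truncn (t * (D ^ n.+1)%:R) < (D ^ n.+1).+1)%N.
  rewrite truncn_lt_nat// (@le_lt_trans _ _ (D ^ n.+1)%:R)//.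
    by rewrite ler_piMl.
  by rewrite ltr_nat.
have -> : grid_floor D n t = ((Ordinal iN %/ D)%N)%:R / (D ^ n)%:R.
  rewrite /grid_floor /=; congr (_%:R / _); apply/eqP; rewrite eqn_leq; apply/andP; split.
    rewrite leq_divRL// truncn_ge_nat// natrM expnSr natrM mulrA.
    by rewrite ler_wpM2r// -truncn_ge_nat.
  rewrite truncn_ge_nat// -(@ler_pM2r _ D%:R) ?ltr0n// -mulrA -!natrM -expnSr.
  by rewrite -truncn_ge_nat ?leq_trunc_div.
exact: (le_bigmax 0 (fun i : 'I_(D ^ n.+1).+1 =>
  `|b (i%:R / (D ^ n.+1)%:R) - b ((i %/ D)%:R / (D ^ n)%:R)|) (Ordinal iN)).
Qed.

Lemma grid_floor_itv (R : realType) (D k : nat) (t : R) :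
  (0 < D)%N -> 0 <= t -> grid_floor D k t <= t < grid_floor D k t + (D ^ k)%:R^-1.
Proof.
move=> D0 t0; have Dk0 : 0 < (D ^ k)%:R :> R by rewrite ltr0n expn_gt0 D0.
have := truncn_itv (mulr_ge0 t0 (ltW Dk0)) => /andP[h1 h2].
rewrite /grid_floor ler_pdivrMr// h1/= -[X in _ + X]mul1r -mulrDl.
by rewrite ltr_pdivlMr// -natr1 in h2 *.
Qed.

Lemma le_norm_grid (R : realType) (b : R -> R) (D : nat) (t r : R) :
  (1 < D)%N -> {within `[0, 1], continuous b} -> 0 <= t <= 1 ->
  (forall n, `|b (grid_floor D n t)| <= r) -> `|b t| <= r.
Proof.
move=> D1 cb /andP[t0 t1] br; apply/ler_addgt0Pr => e e0.
have D0 : (0 < D)%N by exact: ltnW.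
have t01 : [set` `[(0:R), 1]] t by rewrite /= in_itv/= t0 t1.
have /subspace_continuousP/(_ _ t01) := cb.
move=> /cvgrPdist_lt/(_ _ e0).
rewrite near_withinE => -[d /= d0 dP].
have [n nd] : exists n, (D ^ n)%:R^-1 < d.
  exists (Num.truncn d^-1).
  rewrite invf_plt ?posrE ?ltr0n ?expn_gt0 ?D0//.
  apply: (lt_le_trans (truncnS_gt _)).
  by rewrite ler_nat ltn_expl.
have /andP[g1 g2] := grid_floor_itv n D0 t0.
have g0 : 0 <= grid_floor D n t by rewrite /grid_floor divr_ge0.
have : `|b t - b (grid_floor D n t)| < e.
  apply: dP.
    rewrite /ball/= ger0_norm ?subr_ge0// ltrBlDl (lt_trans g2)// ltrD2l//.
  by rewrite /= in_itv/= g0 (le_trans g1).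
move=> h; rewrite -(subrK (b (grid_floor D n t)) (b t)) (le_trans (ler_normD _ _))//.
by rewrite addrC lerD// ltW.
Qed.

(** * The mean of the chaining bound *)

(** The link of the chain from a point of the grid of level k + 1 to the nearest
    point on its left in the grid of level k. *)
Definition chain_increment d (T : measurableType d) (R : realType)
    (P : probability T R) (B : R -> {RV P >-> R}) (D k : nat)
    (i : 'I_(D ^ k.+1).+1) : {RV P >-> R} :=
  (B (i%:R / (D ^ k.+1)%:R) - B ((i %/ D)%:R / (D ^ k)%:R) : {mfun T >-> R}).

Lemma expectation_norm_fbm_le d (T : measurableType d) (R : realType)
    (P : probability T R) (H : R) (B : R -> {RV P >-> R}) (t : R) :
  0 < H -> fractional_brownian_motion P H B -> t \in `[0, 1] ->
  (\int[P]_w `|B t w|%:E <= 2%:E)%E.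
Proof.
move=> H0 fB t01; have H2 : 2 * H != 0 by rewrite mulf_neq0// gt_eqF.
have mB2 : measurable_fun setT (fun w => (B t w * B t w)%:E).
  by apply/measurable_EFinP; exact: measurable_funM.
apply: (@le_trans _ _ (\int[P]_w (cst 1%:E w + (B t w * B t w)%:E))%E).
  apply: ge0_le_integral => //.
  - by apply/measurable_EFinP; exact: measurableT_comp.
  - exact: emeasurable_funD.
  - move=> w _; rewrite -EFinD lee_fin -expr2 -(real_normK (num_real (B t w))).
    have := sqr_ge0 (`|B t w| - 1); rewrite sqrrB mulr1 expr1n => h.
    have := normr_ge0 (B t w); lra.
rewrite ge0_integralD//; last by move=> w _; rewrite lee_fin -expr2 sqr_ge0.
rewrite integral_cst//= probability_setT mule1.
have := fbm_covariance fB t01 t01; rewrite unlock => E2.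
rewrite [X in (_ + X <= _)%E]E2 -EFinD lee_fin subrr normr0 powR0// subr0.
have : `|t| `^ (2 * H) <= 1.
  move: t01; rewrite in_itv/= => /andP[t0 t1].
  have : t `^ (2 * H) <= 1 `^ (2 * H).
    by rewrite ge0_ler_powR// ?nnegrE// mulr_ge0// ltW.
  by rewrite powR1 ger0_norm.
by lra.
Qed.

(** The condition 1 <= m H is what makes the standard deviation |x|^H of a link of
    level k at most 2^-k. *)
Lemma powR_dyadic_le (R : realType) (H x : R) (m k : nat) :
  0 < H -> 1 <= m%:R * H -> `|x| <= ((2 ^ m) ^ k)%:R^-1 ->
  `|x| `^ (2 * H) <= (2^-1 ^+ k) ^+ 2.
Proof.
move=> H0 mH xk; have H2 : 0 <= 2 * H by rewrite mulr_ge0 ?ltW.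
apply: (@le_trans _ _ (((2 ^ m) ^ k)%:R^-1 `^ (2 * H))).
  by rewrite ge0_ler_powR// ?nnegrE.
rewrite -expnM natrX -exprVn -powR_mulrn// -powRrM -exprM -powR_mulrn//.
apply: ger_powR; first by rewrite invr_gt0 ltr0n/= invf_le1// ler1n.
have k0 : 0 <= k%:R :> R by [].
by rewrite !natrM; have := ler_wpM2l k0 mH; lra.
Qed.

(** Used to bound the arithmetico-geometric series of the (k + 1) 2^-k by a
    geometric one. *)
Lemma natr_le_expr_half3 (R : realType) (k : nat) :
  k.+1%:R <= 2 * (3 / 2) ^+ k :> R.
Proof.
elim: k => [|k IH]; first by rewrite expr0; lra.
have : 1 <= (3 / 2) ^+ k :> R by rewrite exprn_ege1//; lra.
by rewrite exprS -[k.+2%:R]natr1; lra.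
Qed.

(** With D = 2^m, the logarithm of the number of links of level k is of order
    m (k + 1).  The parameter sqrt (3 m) (k + 1) trades sqrt (k + 1) for k + 1, which
    the factor 2^-k absorbs, and keeps the dependence in m of order sqrt m. *)
Lemma chain_card_le (R : realType) (m k : nat) : (0 < m)%N ->
  (2 * ((2 ^ m) ^ k.+1).+1)%:R <=
  expR ((Num.sqrt (3 * m%:R) * k.+1%:R) ^+ 2) :> R.
Proof.
move=> m0.
have le2e : 2 <= expR 1 :> R by have := expR_ge1Dx (1 : R); lra.
apply: (@le_trans _ _ (2 ^+ (m * k.+1 + 2))).
  rewrite -natrX ler_nat -expnM.
  have : (0 < 2 ^ (m * k.+1))%N by rewrite expn_gt0.
  by rewrite expnD (_ : 2 ^ 2 = 4)%N//; lia.
apply: (@le_trans _ _ (expR 1 ^+ (m * k.+1 + 2))).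
  by rewrite lerXn2r// nnegrE// ?expR_ge0.
rewrite -expRM_natl mulr1 ler_expR exprMn sqr_sqrtr ?mulr_ge0//.
rewrite -natrX -natrM -natrM ler_nat.
nia.
Qed.

Lemma expectation_chain_level d (T : measurableType d) (R : realType)
    (P : probability T R) (H : R) (B : R -> {RV P >-> R}) (m k : nat) :
  0 < H -> fractional_brownian_motion P H B -> (0 < m)%N -> 1 <= m%:R * H ->
  (\int[P]_w (\big[Num.max/0%R]_i `|chain_increment B (D := 2 ^ m) (k := k) i w|)%:E
   <= (7 * Num.sqrt (3 * m%:R) * (3 / 4) ^+ k)%:E)%E.
Proof.
move=> H0 fB m0 mH.
have D0 : (0 < 2 ^ m)%N by rewrite expn_gt0.
apply: (@le_trans _ _ (7 / 2 * 2^-1 ^+ k * (Num.sqrt (3 * m%:R) * k.+1%:R))%:E).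
  apply: expectation_bigmax_norm_le.
  - by rewrite exprn_gt0// invr_gt0.
  - rewrite mulr_ege1//; last by rewrite ler1n.
    rewrite -[leLHS]sqrtr1 ler_sqrt// -natrM ler1n muln_gt0//.
  - exact: chain_card_le.
  - move=> i l.
    have iD : (i <= (2 ^ m) ^ k.+1)%N by rewrite -ltnS.
    have Dk k' : 0 < ((2 ^ m) ^ k')%:R :> R by rewrite ltr0n expn_gt0 D0.
    have t01 : (i%:R / ((2 ^ m) ^ k.+1)%:R : R) \in `[0, 1].
      by rewrite in_itv/= divr_ge0//= ler_pdivrMr// mul1r ler_nat.
    have s01 : ((i %/ 2 ^ m)%:R / ((2 ^ m) ^ k)%:R : R) \in `[0, 1].
      rewrite in_itv/= divr_ge0//= ler_pdivrMr// mul1r ler_nat.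
      by rewrite -(leq_pmul2r D0) -expnSr (leq_trans _ iD)// leq_trunc_div.
    apply: (le_trans (fbm_increment_mgf l H0 fB s01 t01)).
    have l0 : 0 <= 3 / 2 * l ^+ 2 by rewrite mulr_ge0 ?sqr_ge0.
    rewrite lee_fin ler_expR; apply: (ler_wpM2l l0).
    move: (nat_of_ord i) iD {t01 s01} => {i} i iD.
    apply: (@powR_dyadic_le _ _ _ m) => //.
    have -> : i%:R / ((2 ^ m) ^ k.+1)%:R - (i %/ 2 ^ m)%:R / ((2 ^ m) ^ k)%:R =
        (i %% 2 ^ m)%:R / ((2 ^ m) ^ k.+1)%:R :> R.
      rewrite {1}(divn_eq i (2 ^ m)) natrD natrM expnSr natrM.
      have : (2 ^ m)%:R != 0 :> R by rewrite pnatr_eq0 -lt0n.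
      have : ((2 ^ m) ^ k)%:R != 0 :> R by rewrite gt_eqF.
      move: (2 ^ m)%:R ((2 ^ m) ^ k)%:R => x y y0 x0.
      by field; rewrite x0 y0.
    rewrite ger0_norm ?divr_ge0// ler_pdivrMr// expnSr natrM mulKf ?gt_eqF//.
    by rewrite ler_nat ltnW// ltn_mod.
rewrite lee_fin.
have := natr_le_expr_half3 R k.
have -> : 7 * Num.sqrt (3 * m%:R) * (3 / 4) ^+ k =
    7 / 2 * 2^-1 ^+ k * Num.sqrt (3 * m%:R) * (2 * (3 / 2) ^+ k) :> R.
  rewrite (_ : (3 / 4 : R) = 2^-1 * (3 / 2)); last by field.
  by rewrite exprMn; field.
rewrite !mulrA; set c := _ * Num.sqrt _ => h; rewrite -!(mulrA c).
by rewrite ler_wpM2l// /c !mulr_ge0// ?exprn_ge0 ?sqrtr_ge0// invr_ge0.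
Qed.

(** The chaining bound for sup |B|, with values in the extended reals because the
    series may diverge for some outcomes. *)
Definition chain_bound d (T : measurableType d) (R : realType)
    (P : probability T R) (B : R -> {RV P >-> R}) (D : nat) (w : T) : \bar R :=
  (`|B 0 w|%:E + `|B 1 w|%:E + \sum_(0 <= k <oo)
    (\big[Num.max/0%R]_i `|chain_increment B (D := D) (k := k) i w|)%:E)%E.

Lemma chain_bound_ge0 d (T : measurableType d) (R : realType)
    (P : probability T R) (B : R -> {RV P >-> R}) (D : nat) (w : T) :
  (0 <= chain_bound B D w)%E.
Proof.
rewrite /chain_bound !adde_ge0// ?lee_fin//.
by apply: nneseries_ge0 => k _ _; rewrite lee_fin bigmax_norm_ge0.
Qed.

Lemma measurable_chain_level d (T : measurableType d) (R : realType)
    (P : probability T R) (B : R -> {RV P >-> R}) (D k : nat) :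
  measurable_fun setT
    (fun w => (\big[Num.max/0]_i `|chain_increment B (D := D) (k := k) i w|)%:E).
Proof.
apply/measurable_EFinP; apply: measurable_bigmax_norm => i.
exact: measurable_funPT.
Qed.

Lemma measurable_chain_bound d (T : measurableType d) (R : realType)
    (P : probability T R) (B : R -> {RV P >-> R}) (D : nat) :
  measurable_fun setT (chain_bound B D).
Proof.
apply: emeasurable_funD.
  by apply: emeasurable_funD; apply/measurable_EFinP; exact: measurableT_comp.
apply: ge0_emeasurable_sum => [k w _ _|k _]; first by rewrite lee_fin bigmax_norm_ge0.
exact: measurable_chain_level.
Qed.

Lemma le_chain_bound d (T : measurableType d) (R : realType)
    (P : probability T R) (B : R -> {RV P >-> R}) (D : nat) (w : T) (t : R) :
  (1 < D)%N -> {within `[0, 1], continuous (fun t => B t w)} -> 0 <= t <= 1 ->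
  (`|B t w|%:E <= chain_bound B D w)%E.
Proof.
move=> D1 cB t01; have D0 : (0 < D)%N by exact: ltnW.
have le_grid n : (`|B (grid_floor D n t) w|%:E <= chain_bound B D w)%E.
  pose F k := (\big[Num.max/0]_i `|chain_increment B (D := D) (k := k) i w|)%:E.
  have F0 k : (0 <= F k)%E by rewrite lee_fin bigmax_norm_ge0.
  apply: (@le_trans _ _ (`|B 0 w|%:E + `|B 1 w|%:E + \sum_(0 <= k < n) F k)%E).
    rewrite sumEFin -!EFinD lee_fin.
    exact: (le_norm_chain (fun t => B t w) n D0 t01).
  by rewrite leeD2l//; exact: nneseries_lim_ge.
have := chain_bound_ge0 B D w; case: (chain_bound B D w) le_grid => [r| |].
- move=> le_grid _; rewrite lee_fin; apply: (le_norm_grid D1 cB t01) => n.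
  by rewrite -lee_fin.
- by move=> _ _; exact: leey.
- by move=> _; rewrite leeNy_eq.
Qed.

Lemma expectation_chain_bound d (T : measurableType d) (R : realType)
    (P : probability T R) (H : R) (B : R -> {RV P >-> R}) (m : nat) :
  0 < H -> fractional_brownian_motion P H B -> (0 < m)%N -> 1 <= m%:R * H ->
  (\int[P]_w chain_bound B (2 ^ m) w <= (4 + 28 * Num.sqrt (3 * m%:R))%:E)%E.
Proof.
move=> H0 fB m0 mH.
have mabs t : measurable_fun setT (fun w => `|B t w|%:E).
  by apply/measurable_EFinP; exact: measurableT_comp.
have B_le t : t \in `[0, 1] -> (\int[P]_w `|B t w|%:E <= 2%:E)%E.
  exact: (expectation_norm_fbm_le H0 fB).
pose F k w := (\big[Num.max/0]_i `|chain_increment B (D := 2 ^ m) (k := k) i w|)%:E.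
have F0 k w : (0 <= F k w)%E by rewrite lee_fin bigmax_norm_ge0.
have mF k : measurable_fun setT (F k) by exact: measurable_chain_level.
have mS : measurable_fun setT (fun w => \sum_(0 <= k <oo) F k w)%E.
  exact: ge0_emeasurable_sum.
have a0 : 0 <= 7 * Num.sqrt (3 * m%:R) :> R by rewrite mulr_ge0 ?sqrtr_ge0.
rewrite /chain_bound ge0_integralD//; last 3 first.
- by move=> w _; rewrite -EFinD lee_fin addr_ge0.
- exact: emeasurable_funD.
- by move=> w _; apply: nneseries_ge0 => k _ _; exact: F0.
rewrite ge0_integralD//.
rewrite (_ : 4 + 28 * _ = 2 + 2 + 28 * Num.sqrt (3 * m%:R)); last by ring.
rewrite 2!EFinD leeD//.
  by apply: leeD; apply: B_le; rewrite in_itv/= ?lexx ?ler01.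
rewrite integral_nneseries//; last by move=> k w _; exact: F0.
pose a : R := 7 * Num.sqrt (3 * m%:R).
apply: (@le_trans _ _ (\sum_(0 <= k <oo) (a * (3 / 4) ^+ k)%:E)%E).
  apply: lee_nneseries => [k _ _|k _]; first by apply: integral_ge0 => w _; exact: F0.
  exact: (expectation_chain_level _ H0 fB).
apply: lime_le.
  by apply: is_cvg_nneseries => k _ _; rewrite lee_fin mulr_ge0// exprn_ge0.
apply: nearW => n; rewrite sumEFin lee_fin.
have x1 : `|3 / 4 : R| < 1 by rewrite ger0_norm//; lra.
have x0 : 0 < (3 / 4 : R) by [].
apply: (le_trans (geometric_le_lim n a0 x0 x1)).
by rewrite le_eqVlt; apply/orP; left; apply/eqP; field.
Qed.

(** * The linear equation *)

Lemma within_continuous_norm (R : realType) (A : set R) (f : R -> R) :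
  {within A, continuous f} -> {within A, continuous (fun t => `|f t|)}.
Proof.
move=> /subspace_continuousP cf; apply/subspace_continuousP => t At.
exact: cvg_norm (cf t At).
Qed.

(** At a point c where |x| is maximal, the integral of x over [0, c] is at most
    |x c| in absolute value, since c <= 1. *)
Lemma linear_sde_le (R : realType) (beta sigma r : R) (x b : R -> R) :
  `|beta| < 1 -> {within `[0, 1], continuous x} -> x 0 = 0 ->
  (forall t, t \in `[0, 1] ->
    x t = x 0 + beta * (\int[lebesgue_measure]_(s in `[0, t]) x s) + sigma * b t) ->
  (forall t, 0 <= t <= 1 -> `|b t| <= r) ->
  forall t, 0 <= t <= 1 -> `|x t| <= `|sigma| / (1 - `|beta|) * r.
Proof.
move=> beta1 cx x0 xE br.
have [c c01 cmax] := EVT_max ler01 (within_continuous_norm cx).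
suff xc : `|x c| <= `|sigma| / (1 - `|beta|) * r.
  by move=> t t01; apply: (le_trans (cmax t _) xc); rewrite in_itv.
have /andP[c0 c1] : 0 <= c <= 1 by move: c01; rewrite in_itv.
have ix : lebesgue_measure.-integrable `[0, c] (EFin \o x).
  apply: continuous_compact_integrable; first exact: segment_compact.
  apply: continuous_subspaceW cx => y /=; rewrite !in_itv/= => /andP[-> yc].
  exact: le_trans yc c1.
have intx : `|\int[lebesgue_measure]_(s in `[0, c]) x s| <= `|x c|.
  apply: (le_trans (le_normr_Rintegral _ ix)) => //.
  apply: (@le_trans _ _ (\int[lebesgue_measure]_(s in `[0, c]) `|x c|)).
    apply: le_Rintegral => //.
    - exact: (integrable_norm ix).
    - apply: continuous_compact_integrable; first exact: segment_compact.
      by apply: continuous_subspaceT => y; exact: cvg_cst.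
    - move=> s /=; rewrite in_itv/= => /andP[s0 sc].
      by apply: cmax; rewrite in_itv/= s0 (le_trans sc).
  rewrite Rintegral_cst//= lebesgue_measure_itv/= lte_fin.
  by case: ifPn => _ /=; rewrite ?mulr0// subr0 ler_piMr.
have : `|x c| <= `|beta| * `|x c| + `|sigma| * r.
  rewrite {1}xE// x0 add0r (le_trans (ler_normD _ _))// !normrM lerD//.
    by rewrite ler_wpM2l.
  by rewrite ler_wpM2l// br// c0.
have b1 : 0 < 1 - `|beta| by rewrite subr_gt0.
move=> h; rewrite mulrAC ler_pdivlMr//; lra.
Qed.

(** * The expected supremum *)

(** Here f is an arbitrary function, such as a supremum over uncountably many times.
    The integral of a nonnegative function is defined as a supremum over the simple
    functions below it, so it is monotone whatever the functions.  Replacing g by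
    +oo on the exceptional set makes the inequality hold everywhere. *)
Lemma integral_le_of_ae_le d (T : measurableType d) (R : realType)
    (mu : {measure set T -> \bar R}) (f g : T -> \bar R) :
  measurable_fun setT g -> (forall w, 0 <= g w)%E ->
  {ae mu, forall w, (f w <= g w)%E} ->
  (\int[mu]_w f w <= \int[mu]_w g w)%E.
Proof.
move=> mg g0 [N [mN N0 fgN]].
pose h w := if w \in N then +oo%E else g w.
have h0 w : (0 <= h w)%E by rewrite /h; case: ifP.
have mh : measurable_fun setT h.
  apply: measurable_fun_ifT => //; apply: (measurable_fun_bool true).
  rewrite setTI (_ : _ @^-1` _ = N)//.
  by apply/seteqP; split=> w /= => [/set_mem|/mem_set ->].
have -> : (\int[mu]_w g w = \int[mu]_w h w)%E.
  apply: ge0_ae_eq_integral => //; exists N; split=> // w /= nw.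
  apply: contrapT => Nw; apply: nw => _; rewrite /h ifF//.
  by apply/negbTE; rewrite notin_setE.
have fh w : (f w <= h w)%E.
  rewrite /h; case: ifPn => [_|]; first exact: leey.
  by rewrite notin_setE => Nw; apply: contrapT => fg; apply: Nw; exact: fgN.
rewrite integralE (@le_trans _ _ (\int[mu]_w (f^\+)%E w)%E)//.
  rewrite -[leRHS]adde0 leeD2l// oppe_le0.
  by apply: integral_ge0 => w _; exact: funeneg_ge0.
rewrite !ge0_integralTE//.
apply: ereal_sup_le => _ [s /= sf <-]; exists s => // w.
by rewrite (le_trans (sf w))// funeposE ge_max fh h0.
Qed.

Lemma sup_norm_le (R : realType) (x : R -> R) (a : R) :
  (forall t, 0 <= t <= 1 -> `|x t| <= a) -> sup [set x t | t in `[0, 1]] <= a.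
Proof.
move=> xa; apply: ge_sup.
  by exists (x 0), 0 => //=; rewrite in_itv/= lexx ler01.
by move=> _ [t /= t01 <-]; rewrite (le_trans (ler_norm _))// xa.
Qed.

Theorem theorem1 (R : realType) (sigma beta : R) (hbeta : `|beta| < 1) :
  let C_beta := expR (3 * beta) in
  exists2 C : R, 0 < C &
    forall H : R, 0 < H < 1 ->
    forall (d : measure_display) (T : measurableType d) (P : probability T R)
      (B X : R -> {RV P >-> R}),
      fractional_brownian_motion P H B ->
      linear_sde_solution P beta sigma 0 B X ->
      ('E_P[fun w => sup [set X t w | t in `[0%R, 1%R]]] <=
        (C * (`|sigma| * Num.sqrt C_beta
              + `|sigma| * Num.sqrt (C_beta * pi / H)))%:E)%E.
Proof.
move=> Cb.
have b0 : 0 < 1 - `|beta| by rewrite subr_gt0.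
have Cb0 : 0 < Num.sqrt Cb by rewrite sqrtr_gt0 expR_gt0.
exists (56 / (1 - `|beta|) / Num.sqrt Cb); first by rewrite !divr_gt0.
move=> H /andP[H0 H1] d T P B X fB sX.
(* the number of dyadic levels from one net to the next; 1 / H <= m is needed for the
   links to halve, m <= 2 / H for the rate in H *)
pose m := (Num.truncn H^-1).+1.
have V0 : 0 < H^-1 by rewrite invr_gt0.
have mH : 1 <= m%:R * H.
  by rewrite -ler_pdivrMr// mul1r ltW// truncnS_gt.
have m2 : m%:R <= 2 / H.
  rewrite /m -natr1 mulr_natl mulr2n lerD//.
    by have /andP[] := truncn_itv (ltW V0).
  by rewrite invf_ge1// ltW.
have m0 : (0 < m)%N by [].
have D1 : (1 < 2 ^ m)%N by rewrite -[X in (X < _)%N](expn0 2) ltn_exp2l.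
pose K := `|sigma| / (1 - `|beta|).
have K0 : 0 <= K by rewrite divr_ge0// ltW.
have mS := measurable_chain_bound B (2 ^ m).
have S0 := chain_bound_ge0 B (2 ^ m).
rewrite unlock (@le_trans _ _ (\int[P]_w (K%:E * chain_bound B (2 ^ m) w))%E)//.
  apply: integral_le_of_ae_le.
  - exact: measurable_funeM.
  - by move=> w; rewrite mule_ge0.
  - have := sde_init sX; have := sde_equation sX.
    apply: filterS2 => w Xw X0.
    have cB : {within `[0, 1], continuous (fun t => B t w)}.
      exact: (fbm_continuous fB).
    have cX : {within `[0, 1], continuous (fun t => X t w)}.
      exact: (sde_continuous sX).
    have Bw t : 0 <= t <= 1 -> (`|B t w|%:E <= chain_bound B (2 ^ m) w)%E.
      exact: le_chain_bound.
    have [r br r_le] : exists2 r : R, (forall t, 0 <= t <= 1 -> `|B t w| <= r) &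
        (r%:E <= chain_bound B (2 ^ m) w)%E.
      have [c c01 cmax] := EVT_max ler01 (within_continuous_norm cB).
      exists `|B c w|; last by apply: Bw; move: c01; rewrite in_itv.
      by move=> t t01; apply: cmax; rewrite in_itv.
    apply: (@le_trans _ _ (K * r)%:E).
      rewrite lee_fin; apply: sup_norm_le.
      exact: (linear_sde_le hbeta cX X0 Xw br).
    by rewrite EFinM lee_wpmul2l.
rewrite ge0_integralZl//.
apply: (@le_trans _ _ (K * (4 + 28 * Num.sqrt (3 * m%:R)))%:E).
  by rewrite [leRHS]EFinM lee_wpmul2l// (expectation_chain_bound H0 fB).
rewrite lee_fin.
have sm : Num.sqrt (3 * m%:R) <= 2 * Num.sqrt (pi / H).
  have -> : 2 * Num.sqrt (pi / H) = Num.sqrt (2 ^+ 2 * (pi / H)).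
    by rewrite [RHS]sqrtrM ?sqr_ge0// sqrtr_sqr ger0_norm.
  rewrite ler_wsqrtr//.
  have := ler_wpM2r (ltW V0) (pi_ge2 R); lra.
rewrite -(mulrA Cb) (sqrtrM _ (expR_ge0 _)) -/Cb.
have -> : 56 / (1 - `|beta|) / Num.sqrt Cb *
    (`|sigma| * Num.sqrt Cb + `|sigma| * (Num.sqrt Cb * Num.sqrt (pi / H))) =
    K * (56 + 56 * Num.sqrt (pi / H)).
  by rewrite /K; field; rewrite !gt_eqF.
rewrite ler_wpM2l//; lra.
Qed.
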